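(* Let $R\in\operatorname{Ob}(\hat{\mathcal C})$ with residue field $k\notin\{\mathbb F_2,\mathbb F_3,\mathbb F_5\}$, $G=\mathrm{SL}_2(R)$, $\bar\rho:G\to\mathrm{GL}_2(k)$ induced by reduction, and $\iota:G\hookrightarrow\mathrm{GL}_2(R)$ the inclusion. Then $\iota$ is a universal lift of $\bar\rho$.
   Context: Let $k$ be a finite field. $\hat{\mathcal C}$ is the category of complete noetherian local commutative rings with residue field $k$, with local homomorphisms inducing the identity on $k$; $\mathfrak m_S$ is the maximal ideal of $S$. For a profinite group $G$ and continuous $\bar\rho:G\to\mathrm{GL}_n(k)$, a lift to $S$ is a continuous $\rho:G\to\mathrm{GL}_n(S)$ reducing to $\bar\rho$; lifts are strictly equivalent if conjugate by an element of $I+M_n(\mathfrak m_S)$; $\mathrm{Def}_{\bar\rho}(S)$ is the set of strict equivalence classes. A lift $\rho$ to $R$ is universal if $f\mapsto[\mathrm{GL}_n(f)\circ\rho]$ ($\mathrm{GL}_n(f)$ applies $f$ entrywise) is a natural isomorphism $\mathrm{Hom}_{\hat{\mathcal C}}(R,-)\to\mathrm{Def}_{\bar\rho}$. $\mathrm{SL}_n(R)$ carries its profinite topology. *)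

(* Defs.v *)
From HB Require Import structures.
From mathcomp Require Import all_boot all_order all_algebra.
Set Implicit Arguments. Unset Strict Implicit. Unset Printing Implicit Defensive.
Import GRing.Theory.
Local Open Scope ring_scope.

Definition is_ideal (R : comUnitRingType) (I : R -> Prop) : Prop :=
  I 0 /\ (forall x y, I x -> I y -> I (x + y)) /\ (forall r x, I x -> I (r * x)).

Definition fin_gen (R : comUnitRingType) (I : R -> Prop) : Prop :=
  exists s : seq R, forall x, I x <-> exists c : nat -> R, x = \sum_(i < size s) c i * s`_i.

Definition noetherian (R : comUnitRingType) : Prop :=
  forall I : R -> Prop, is_ideal I -> fin_gen I.

Fixpoint mpow (R : comUnitRingType) (m : R -> Prop) (n : nat) : R -> Prop :=
  match n with
  | 0 => fun _ => True
  | n'.+1 => fun x => exists l : seq (R * R),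
      (forall p, p \in l -> m p.1 /\ mpow m n' p.2) /\ x = \sum_(p <- l) p.1 * p.2
  end.

(* Objects of \hat C: complete noetherian local rings with residue field k,
   given together with the reduction map red : R ->> k whose kernel is the
   maximal ideal. *)
Record cobj (k : finFieldType) := CObj {
  cring :> comUnitRingType;
  cred : {rmorphism cring -> k};
  cred_surj : forall y : k, exists x : cring, cred x = y;
  cred_local : forall x : cring, cred x != 0 -> x \is a GRing.unit;
  c_noeth : noetherian cring;
  c_separated : forall x : cring,
      (forall n, mpow (fun y => cred y = 0) n x) -> x = 0;
  c_complete : forall u : nat -> cring,
      (forall n, exists N, forall i j, (N <= i)%N -> (N <= j)%N ->
          mpow (fun y => cred y = 0) n (u i - u j)) ->
      exists l : cring, forall n, exists N, forall i, (N <= i)%N ->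
          mpow (fun y => cred y = 0) n (u i - l)
}.

Definition cmax {k : finFieldType} (S : cobj k) : S -> Prop := fun x => cred S x = 0.
Arguments cmax {k} S.
Definition cmpow {k : finFieldType} (S : cobj k) (n : nat) : S -> Prop := mpow (cmax S) n.
Arguments cmpow {k} S n.

(* morphisms of \hat C: ring maps inducing the identity on k
   (locality follows) *)
Definition chom (k : finFieldType) (R S : cobj k) (f : {rmorphism R -> S}) : Prop :=
  forall x, cred S (f x) = cred R x.

Definition mx_in (S : comUnitRingType) (I : S -> Prop) (M : 'M[S]_2) : Prop :=
  forall i j, I (M i j).

Definition inSL2 (S : comUnitRingType) (g : 'M[S]_2) : Prop := \det g = 1.

Definition cong1 (k : finFieldType) (S : cobj k) (j : nat) (M : 'M[S]_2) : Prop :=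
  mx_in (cmpow S j) (M - 1%:M).

(* rho : SL_2(R) -> GL_2(S) (represented as a function on all 2x2 matrices,
   only its values on SL_2(R) matter) is a lift to S of
   rhobar : SL_2(R) -> GL_2(k), the reduction map:
   a continuous group homomorphism into GL_2(S) reducing to rhobar.
   Continuity (profinite = m_R-adic topology on SL_2(R), m_S-adic on GL_2(S))
   is written as continuity at the identity of a homomorphism. *)
Definition is_lift (k : finFieldType) (R S : cobj k) (rho : 'M[R]_2 -> 'M[S]_2) : Prop :=
  [/\ (forall g, inSL2 g -> rho g \in unitmx),
      (forall g h, inSL2 g -> inSL2 h -> rho (g *m h) = rho g *m rho h),
      (forall g, inSL2 g -> map_mx (cred S) (rho g) = map_mx (cred R) g)
    & (forall j, exists i, forall g, inSL2 g -> cong1 i g -> cong1 j (rho g))].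

Definition strict_equiv (k : finFieldType) (R S : cobj k)
    (rho rho' : 'M[R]_2 -> 'M[S]_2) : Prop :=
  exists P : 'M[S]_2, mx_in (cmax S) (P - 1%:M) /\
    forall g, inSL2 g -> rho' g = P *m rho g *m invmx P.

(* rho is a universal lift: it is a lift, and for every S in \hat C the map
   Hom(R,S) -> Def(S), f |-> [GL_2(f) o rho], is well defined and bijective
   (naturality is automatic). *)
Definition universal_lift (k : finFieldType) (R : cobj k) (rho : 'M[R]_2 -> 'M[R]_2) : Prop :=
  is_lift rho /\
  forall S : cobj k,
    [/\ (forall f : {rmorphism R -> S}, chom f ->
            is_lift (fun g => map_mx f (rho g))),
        (forall rho' : 'M[R]_2 -> 'M[S]_2, is_lift rho' ->
            exists f : {rmorphism R -> S},
              chom f /\ strict_equiv (fun g => map_mx f (rho g)) rho')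
      & (forall f f' : {rmorphism R -> S}, chom f -> chom f' ->
            strict_equiv (fun g => map_mx f (rho g)) (fun g => map_mx f' (rho g)) ->
            forall x, f x = f' x)].

(* Main.v *)
(** Write t(x), l(x) for the upper and lower elementary matrices and
    d(u) = diag(u, 1/u).  Since k is not F_2, F_3 or F_5, some unit a of R has
    a^4 <> 1 modulo the maximal ideal.  Given a lift rho, the matrix rho(d(a))
    has distinct eigenvalues modulo the maximal ideal, so by Hensel's lemma it
    becomes diagonal after a strict conjugation, and a further diagonal
    conjugation makes the upper right entry of rho(t(1)) equal to 1.  Every
    rho(t(x)) commutes with rho(t(1)), and conjugation by d(a) multiplies x by
    a^2; comparing entries, the condition on a forces rho(t(x)) = t(b(x)) with
    b additive.  The Weyl elements w(u) = t(u) l(-1/u) t(u) exchange d(a) and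
    its inverse, so rho(w(u)) is antidiagonal; this gives rho(w(u)) = w(b(u)),
    hence rho(d(u)) = d(b(u)), so b is multiplicative on units and therefore a
    ring homomorphism R -> S inducing rho. *)
Require Import Defs.
From HB Require Import structures.
From mathcomp Require Import all_boot all_order all_algebra.
From mathcomp Require Import finfield ring.
Set Implicit Arguments. Unset Strict Implicit. Unset Printing Implicit Defensive.
Import GRing.Theory.
Local Open Scope ring_scope.

(** * Powers of the maximal ideal and a quadratic Hensel lemma *)

Lemma mpow0 (S : comUnitRingType) (m : S -> Prop) n : mpow m n 0.
Proof. by case: n => //= n; exists [::]; rewrite big_nil. Qed.

Lemma mpowD (S : comUnitRingType) (m : S -> Prop) n x y :
  mpow m n x -> mpow m n y -> mpow m n (x + y).
Proof.
case: n => //= n [l1 [h1 ->]] [l2 [h2 ->]]; exists (l1 ++ l2).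
rewrite big_cat; split=> // p.
by rewrite mem_cat => /orP[/h1|/h2].
Qed.

Section MaximalIdealPowers.
Variables (k : finFieldType) (S : cobj k).
Implicit Types x y u r : S.

Lemma cmpowMl n r x : cmpow S n x -> cmpow S n (r * x).
Proof.
case: n => //= n [l [h ->]]; exists [seq (r * p.1, p.2) | p <- l].
split; last first.
  by rewrite big_map big_distrr; apply: eq_bigr => p _; rewrite /= mulrA.
move=> p /mapP[p' /h[hp1 hp2] ->] /=; split=> //.
by rewrite /cmax rmorphM /= [cred S p'.1]hp1 mulr0.
Qed.

Lemma cmpowB n x y : cmpow S n x -> cmpow S n y -> cmpow S n (x - y).
Proof. by move=> hx hy; apply: mpowD => //; rewrite -mulN1r; apply: cmpowMl. Qed.

Lemma cmpowS n r x : cmax S r -> cmpow S n x -> cmpow S n.+1 (r * x).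
Proof.
move=> hr hx; exists [:: (r, x)]; rewrite big_seq1; split=> // p.
by rewrite inE => /eqP ->.
Qed.

Lemma cmpowW n i x : cmpow S (n + i) x -> cmpow S n x.
Proof.
elim: n x => // n IH x; rewrite addSn => -[l [h ->]]; exists l; split=> // p.
by case/h => h1 /IH.
Qed.

Lemma cmpow1 x : cmpow S 1 x <-> cmax S x.
Proof.
split=> [[l [h ->]]|hx]; last by rewrite -[x]mulr1; apply: cmpowS.
rewrite /cmax rmorph_sum big1_seq // => p /= /h[hp _].
by rewrite rmorphM /= [cred S p.1]hp mul0r.
Qed.

Lemma cunitE x : (x \is a GRing.unit) = (cred S x != 0).
Proof.
apply/idP/idP; last exact: cred_local.
by move/(rmorph_unit (cred S)); rewrite unitfE.
Qed.

Lemma creg_eq0 x u : cred S u != 0 -> x * u = 0 -> x = 0.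
Proof. by rewrite -cunitE => hu h; apply: (mulIr hu); rewrite mul0r. Qed.

(* [y] is the fixed point of the contraction [y |-> (r - q y^2) / u]. *)
Lemma hensel_quadratic q u r : cmax S q -> cred S u != 0 -> cmax S r ->
  exists y, cmax S y /\ q * y ^+ 2 + u * y = r.
Proof.
move=> hq; rewrite -cunitE => hu hr.
pose phi y := (r - q * y ^+ 2) * u^-1.
pose s n := iter n phi 0.
(* The difference carries the factor [q] of the maximal ideal, so [phi] gains one power. *)
have phiB n x y : cmpow S n (x - y) -> cmpow S n.+1 (phi x - phi y).
  move=> h; have -> : phi x - phi y = - ((x + y) * u^-1) * (q * (x - y)).
    by rewrite /phi; ring.
  by apply: cmpowMl; apply: cmpowS.
have sm n : cmax S (s n).
  case: n => [|n]; first exact: rmorph0.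
  by rewrite /cmax /s /= /phi rmorphM rmorphB rmorphM /= [cred S r]hr
    [cred S q]hq mul0r subr0 mul0r.
(* Both terms are [n]-fold iterates, of [s i] and of [0]; the zeroth power is the whole ring, so the
   induction starts for free. *)
have s_step n i : cmpow S n (s (n + i)%N - s n).
  elim: n => [|n IH]; first by [].
  by rewrite addSn; apply: phiB.
have s_cauchy n i j : (n <= i)%N -> (n <= j)%N -> cmpow S n (s i - s j).
  move=> /subnKC <- /subnKC <-.
  have -> : s (n + (i - n))%N - s (n + (j - n))%N
    = (s (n + (i - n))%N - s n) - (s (n + (j - n))%N - s n) by ring.
  exact: cmpowB.
have [|y hy] := @c_complete k S s; first by move=> n; exists n => i j; apply: s_cauchy.
have ym : cmax S y.
  have [N hN] := hy 1%N; have /cmpow1 := hN N (leqnn N).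
  by rewrite /cmax rmorphB /= [cred S (s N)]sm sub0r => /eqP; rewrite oppr_eq0 => /eqP.
exists y; split=> //.
(* Approximating [y] by [s N] puts [phi y - y] in every power of the maximal ideal, and the ring is
   separated. *)
have fixy : phi y - y = 0.
  apply: (@c_separated k S) => n; have [N hN] := hy n.
  have h1 := hN N (leqnn N); have h2 := hN N.+1 (leqnSn N).
  have -> : phi y - y = (s N.+1 - y) - (phi (s N) - phi y) by rewrite /s /=; ring.
  by apply: cmpowB => //; apply: (@cmpowW _ 1); rewrite addn1; apply: phiB.
have /(congr1 (fun z => z * u)) : phi y = y by apply/eqP; rewrite -subr_eq0 fixy.
by rewrite /phi mulrVK // => h; rewrite [u * y]mulrC -h; ring.
Qed.

End MaximalIdealPowers.

(** * Elementary, diagonal and Weyl matrices of size two *)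

Section TwoByTwo.
Variable S : comUnitRingType.
Implicit Types a b c d x y : S.

Definition mx2 a b c d : 'M[S]_2 :=
  \matrix_(i, j) if i == 0 then if j == 0 then a else b
                 else if j == 0 then c else d.

Definition tmx x := mx2 1 x 0 1.
Definition lmx x := mx2 1 0 x 1.
Definition dmx x := mx2 x 0 0 x^-1.
Definition wmx x := mx2 0 x (- x^-1) 0.

Lemma mx2_eta (M : 'M[S]_2) : M = mx2 (M 0 0) (M 0 1) (M 1 0) (M 1 1).
Proof.
apply/matrixP => i j; rewrite mxE.
by case: i j => [[|[|i]] // hi] [[|[|j]] // hj]; congr (M _ _); apply: val_inj.
Qed.

Lemma mx2_inj a b c d a' b' c' d' :
  mx2 a b c d = mx2 a' b' c' d' -> [/\ a = a', b = b', c = c' & d = d'].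
Proof.
by move/matrixP=> h; split; [have := h 0 0|have := h 0 1|have := h 1 0|have := h 1 1];
  rewrite !mxE.
Qed.

Lemma mul_mx2 a b c d a' b' c' d' :
  mx2 a b c d *m mx2 a' b' c' d' =
  mx2 (a * a' + b * c') (a * b' + b * d') (c * a' + d * c') (c * b' + d * d').
Proof.
by rewrite [LHS]mx2_eta !mxE !big_ord_recl !big_ord0 !mxE /= !addr0.
Qed.

Lemma det_mx2 a b c d : \det (mx2 a b c d) = a * d - b * c.
Proof.
rewrite (expand_det_row _ 0) !big_ord_recl big_ord0 /cofactor !det_mx11 !mxE /=.
by rewrite addr0 expr0 mul1r expr1 mulN1r mulrN.
Qed.

Lemma mx2_1 : mx2 1 0 0 1 = 1%:M.
Proof. by rewrite [RHS]mx2_eta !mxE. Qed.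

Lemma SL2_tmx x : inSL2 (tmx x).
Proof. by rewrite /inSL2 det_mx2; ring. Qed.

Lemma SL2_lmx x : inSL2 (lmx x).
Proof. by rewrite /inSL2 det_mx2; ring. Qed.

Lemma SL2_dmx x : x \is a GRing.unit -> inSL2 (dmx x).
Proof. by move=> hx; rewrite /inSL2 det_mx2 mulr0 subr0 mulrV. Qed.

Lemma SL2_wmx x : x \is a GRing.unit -> inSL2 (wmx x).
Proof. by move=> hx; rewrite /inSL2 det_mx2 mulr0 mulrN mulrV // opprK add0r. Qed.

Lemma SL2_mul (g h : 'M[S]_2) : inSL2 g -> inSL2 h -> inSL2 (g *m h).
Proof. by rewrite /inSL2 det_mulmx => -> ->; rewrite mulr1. Qed.

Lemma tmxD x y : tmx (x + y) = tmx x *m tmx y.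
Proof. by rewrite mul_mx2; congr mx2; ring. Qed.

Lemma lmxD x y : lmx (x + y) = lmx x *m lmx y.
Proof. by rewrite mul_mx2; congr mx2; ring. Qed.

Lemma tmx_conj u x : u \is a GRing.unit ->
  dmx u *m tmx x = tmx (u ^+ 2 * x) *m dmx u.
Proof.
move=> hu; rewrite !mul_mx2; congr mx2; try by ring.
by rewrite mul0r mulr0 addr0 add0r expr2 mulrAC mulrK.
Qed.

Lemma wmx_conj u x : u \is a GRing.unit -> dmx u *m (wmx x *m dmx u) = wmx x.
Proof.
move=> hu; rewrite !mul_mx2 !(mulr0, mul0r, addr0, add0r); congr mx2.
  by rewrite mulrCA mulrV ?mulr1.
by rewrite mulrCA mulVr ?mulr1.
Qed.

Lemma lmx_wmx x : lmx x *m wmx 1 = wmx 1 *m tmx (- x).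
Proof. by rewrite !mul_mx2 invr1; congr mx2; ring. Qed.

Lemma wmxE x : x \is a GRing.unit -> wmx x = tmx x *m (lmx (- x^-1) *m tmx x).
Proof.
move=> hx; rewrite !mul_mx2 !(mulr0, mul0r, addr0, add0r, mul1r, mulr1).
by rewrite !(mulrN, mulNr) mulrV // mulVr // addNr mulr0 subrr addr0.
Qed.

Lemma dmxE x : dmx x = wmx x *m wmx (- 1).
Proof. by rewrite !mul_mx2 invrN invr1; congr mx2; ring. Qed.

(** Gaussian elimination with a unit pivot; the determinant condition fixes the lower right
    entry. *)
Lemma SL2_LDU (g : 'M[S]_2) : inSL2 g -> g 0 0 \is a GRing.unit ->
  g = lmx (g 1 0 / g 0 0) *m (dmx (g 0 0) *m tmx (g 0 1 / g 0 0)).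
Proof.
move=> hg hu; rewrite {1}[g]mx2_eta !mul_mx2.
move: hg; rewrite /inSL2 [g in \det g]mx2_eta det_mx2.
move: (g 0 0) (g 0 1) (g 1 0) (g 1 1) hu => x y z w hx h.
rewrite !(mulr0, mul0r, addr0, add0r, mul1r, mulr1); congr mx2.
- by rewrite mulrC mulrVK.
- by rewrite mulrVK.
have -> : w = (x * w - y * z + y * z) * x^-1 by rewrite subrK mulrC mulKr.
rewrite h mulrDl mul1r addrC; congr (_ + _).
by rewrite [x * _]mulrCA mulrV // mulr1 [RHS]mulrC mulrA.
Qed.

(* The commutant of a matrix with a unit (here [1]) off the diagonal is
   spanned by the identity and that matrix. *)
Lemma comm_mx2 a0 c0 d0 a b c d :
  mx2 a b c d *m mx2 a0 1 c0 d0 = mx2 a0 1 c0 d0 *m mx2 a b c d ->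
  c = c0 * b /\ d - a = (d0 - a0) * b.
Proof.
rewrite !mul_mx2 => /mx2_inj[h1 h2 _ _]; split.
  rewrite mul1r [a * a0]mulrC in h1; move/addrI: h1 => <-; exact: mulrC.
move: h2; rewrite mulr1 mul1r => h2.
have -> : d = a + b * d0 - a0 * b by rewrite h2; ring.
ring.
Qed.

End TwoByTwo.

Lemma map_mx2 (S T : comUnitRingType) (f : {rmorphism S -> T}) a b c d :
  map_mx f (mx2 a b c d) = mx2 (f a) (f b) (f c) (f d).
Proof. by rewrite [LHS]mx2_eta !mxE. Qed.

(** * Representations with [rho (dmx a)] diagonal and [rho (tmx 1)] normalized *)

Definition sl2_rep (k : finFieldType) (R S : cobj k) (rho : 'M[R]_2 -> 'M[S]_2) :=
  [/\ (forall g, inSL2 g -> rho g \in unitmx),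
      (forall g h, inSL2 g -> inSL2 h -> rho (g *m h) = rho g *m rho h)
    & (forall g, inSL2 g -> map_mx (cred S) (rho g) = map_mx (cred R) g)].

Section NormalizedRepresentation.
Variables (k : finFieldType) (R S : cobj k) (rho : 'M[R]_2 -> 'M[S]_2).
Variables (a : R) (lam mu : S).
Hypothesis rhoP : sl2_rep rho.
Hypothesis a4 : cred R a ^+ 4 != 1.
Hypothesis a0 : cred R a != 0.
Hypothesis rho_a : rho (dmx a) = mx2 lam 0 0 mu.
Hypothesis rho_t1 : rho (tmx 1) 0 1 = 1.

Let rhoM g h : inSL2 g -> inSL2 h -> rho (g *m h) = rho g *m rho h.
Proof. by case: rhoP => _ + _; apply. Qed.

Let rho_red g i j : inSL2 g -> cred S (rho g i j) = cred R (g i j).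
Proof. by case: rhoP => _ _ h /h /matrixP/(_ i j); rewrite !mxE. Qed.

Let aU : a \is a GRing.unit. Proof. by rewrite cunitE. Qed.

Let a2 : cred R a ^+ 2 != 1.
Proof. by apply: contra a4 => /eqP h; rewrite (exprM _ 2 2) h expr1n. Qed.

Let a2B1 : a ^+ 2 - 1 \is a GRing.unit.
Proof. by rewrite cunitE rmorphB rmorphXn rmorph1 subr_eq0. Qed.

Let lam_red : cred S lam = cred R a.
Proof. by have := rho_red 0 0 (SL2_dmx aU); rewrite rho_a !mxE. Qed.

Let mu_red : cred S mu = (cred R a)^-1.
Proof.
by have := rho_red 1 1 (SL2_dmx aU); rewrite rho_a !mxE /= rmorphV.
Qed.

Let muU : cred S mu != 0. Proof. by rewrite mu_red invr_eq0. Qed.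

Let tb x := rho (tmx x) 0 1.
Let lc x := rho (lmx x) 1 0.

(** Conjugation by [rho (dmx a)] fixes the diagonal entries and scales the others by [lam / mu] and
    [mu / lam]; the equations are kept free of division. *)
Let tmx_conjE A B C E x : rho (tmx x) = mx2 A B C E ->
  let V := rho (tmx (a ^+ 2 * x)) in
  [/\ V 0 0 = A, mu * V 0 1 = lam * B, lam * V 1 0 = mu * C & V 1 1 = E].
Proof.
move=> hU V; have := congr1 rho (tmx_conj x aU).
rewrite (rhoM (SL2_dmx aU) (SL2_tmx x)) (rhoM (SL2_tmx _) (SL2_dmx aU)).
rewrite rho_a hU -/V [V]mx2_eta !mul_mx2 !mxE /=.
rewrite !(mul0r, mulr0, add0r, addr0) => /mx2_inj[h1 h2 h3 h4].
have lamU : lam \is a GRing.unit by rewrite cunitE lam_red.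
have muU' : mu \is a GRing.unit by rewrite cunitE.
split; last by apply: (mulIr muU'); rewrite -h4 mulrC.
- by apply: (mulIr lamU); rewrite -h1 mulrC.
- by rewrite h2 mulrC.
- by rewrite h3 mulrC.
Qed.

Lemma rho_tmx x : rho (tmx x) = tmx (tb x).
Proof.
have comm y : rho (tmx y) 1 0 = rho (tmx 1) 1 0 * tb y /\
    rho (tmx y) 1 1 - rho (tmx y) 0 0
      = (rho (tmx 1) 1 1 - rho (tmx 1) 0 0) * tb y.
  apply: comm_mx2; rewrite -rho_t1 -!mx2_eta -!rhoM; try exact: SL2_tmx.
  by rewrite -!tmxD addrC.
have [e00 e01 e10 e11] := tmx_conjE (mx2_eta (rho (tmx 1))).
rewrite rho_t1 in e01.
have [h1 h2] := comm (a ^+ 2 * 1).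
set c0 := rho (tmx 1) 1 0 in e10 h1 comm; set V := rho _ in e00 e01 e10 e11 h1 h2.
rewrite -/(V 0 1) in h1 h2.
(* The lower left entry at [a ^+ 2] is [c0 * V 0 1], which is [c0] scaled by [lam / mu], whereas
   conjugation scales [c0] by [mu / lam]. As [a ^+ 4] is not 1 in [k], [lam ^+ 2 - mu ^+ 2] is a
   unit. *)
have c0_eq0 : c0 = 0.
  apply: (@creg_eq0 _ _ _ (lam ^+ 2 - mu ^+ 2)).
    rewrite rmorphB !rmorphXn /= lam_red mu_red subr_eq0.
    apply: contra a4 => /eqP h; rewrite (exprM _ 2 2) {1}expr2 {1}h -exprMn.
    by rewrite mulVf ?expr1n.
  have -> : c0 * (lam ^+ 2 - mu ^+ 2)
    = lam * c0 * (lam * 1 - mu * V 0 1) + mu * (lam * (c0 * V 0 1) - mu * c0) by ring.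
  by rewrite -e01 subrr mulr0 -h1 e10 subrr mulr0 addr0.
(* Conjugation preserves this difference, but the commutant relation scales it by [lam / mu];
   [lam - mu] is a unit. *)
have E0 : rho (tmx 1) 1 1 - rho (tmx 1) 0 0 = 0.
  set e := (X in X = 0); rewrite -/e in h2.
  apply: (@creg_eq0 _ _ _ (lam - mu)).
    rewrite rmorphB /= lam_red mu_red subr_eq0.
    by apply: contra a2 => /eqP h; rewrite expr2 {1}h mulVf.
  have -> : e * (lam - mu) = mu * (e * V 0 1 - e) + e * (lam * 1 - mu * V 0 1) by ring.
  by rewrite -h2 e00 e11 subrr mulr0 e01 subrr mulr0 addr0.
have diag y : rho (tmx y) = mx2 (rho (tmx y) 0 0) (tb y) 0 (rho (tmx y) 0 0).
  have [g1 g2] := comm y; rewrite [LHS]mx2_eta g1 c0_eq0 mul0r; congr mx2.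
  by move/eqP: g2; rewrite E0 mul0r subr_eq0 => /eqP.
(* With [z = y / (a ^+ 2 - 1)], the product [tmx y *m tmx z] is [tmx (a ^+ 2 * z)], a conjugate of
   [tmx z] by [dmx a]. Its image has the same corner entry as that of [tmx z], and this unit
   cancels. *)
suff D1 y : rho (tmx y) 0 0 = 1 by rewrite diag D1.
have [_ _ _ _] := tmx_conjE (mx2_eta (rho (tmx (y / (a ^+ 2 - 1))))).
have [+ _ _ _] := tmx_conjE (mx2_eta (rho (tmx (y / (a ^+ 2 - 1))))).
set z := y / _; have -> : a ^+ 2 * z = y + z.
  rewrite -[X in X + _](mulrVK a2B1 y) -/z; ring.
rewrite tmxD (rhoM (SL2_tmx _) (SL2_tmx _)) (diag y) (diag z) mul_mx2 !mxE /=.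
rewrite mulr0 addr0 -[X in _ = X]mul1r; apply: mulIr.
by rewrite cunitE rho_red ?mxE ?rmorph1 ?oner_eq0 //; apply: SL2_tmx.
Qed.

Let tb1 : tb 1 = 1. Proof. exact: rho_t1. Qed.

Let tbD x y : tb (x + y) = tb x + tb y.
Proof.
by rewrite {1}/tb tmxD rhoM ?rho_tmx ?mul_mx2 ?mxE /=; [ring|exact: SL2_tmx..].
Qed.

Let tbN x : tb (- x) = - tb x.
Proof.
have tb0 : tb 0 = 0 by apply: (addIr (tb 0)); rewrite -tbD !add0r.
by apply: (addIr (tb x)); rewrite -tbD !addNr.
Qed.

Lemma tb_red x : cred S (tb x) = cred R x.
Proof. by rewrite rho_red ?mxE //; apply: SL2_tmx. Qed.

Let tbU x : x \is a GRing.unit -> tb x \is a GRing.unit.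
Proof. by rewrite !cunitE tb_red. Qed.

(** By [wmx_conj] the diagonal entries are killed by [lam ^+ 2 - 1] and [mu ^+ 2 - 1], units since
    [a ^+ 2] is not 1 in [k]. *)
Let rho_wmx_anti x : x \is a GRing.unit ->
  rho (wmx x) = mx2 0 (rho (wmx x) 0 1) (rho (wmx x) 1 0) 0.
Proof.
move=> hx; have sw := SL2_wmx hx; have sd := SL2_dmx aU.
have := congr1 rho (wmx_conj x aU).
rewrite (rhoM sd (SL2_mul sw sd)) (rhoM sw sd) rho_a.
set W := rho _; rewrite {1 2}[W]mx2_eta !mul_mx2 !(mul0r, mulr0, add0r, addr0).
case/mx2_inj=> h1 _ _ h2; rewrite [LHS]mx2_eta; congr mx2.
- apply: (@creg_eq0 _ _ _ (lam ^+ 2 - 1)).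
    by rewrite rmorphB rmorphXn rmorph1 /= lam_red subr_eq0.
  by rewrite mulrBr mulr1 -[X in _ - X]h1; ring.
- apply: (@creg_eq0 _ _ _ (mu ^+ 2 - 1)).
    rewrite rmorphB rmorphXn rmorph1 /= mu_red subr_eq0 exprVn.
    by rewrite invr_eq1.
  by rewrite mulrBr mulr1 -[X in _ - X]h2; ring.
Qed.

(** The antidiagonal matrix [rho (wmx 1)], with unit entries, carries the upper unipotent shape to
    the lower one. *)
Lemma rho_lmx x : rho (lmx x) = lmx (lc x).
Proof.
have U1 := unitr1 R.
have := congr1 rho (lmx_wmx x).
rewrite (rhoM (SL2_lmx x) (SL2_wmx U1)) (rhoM (SL2_wmx U1) (SL2_tmx _)).
rewrite rho_tmx (rho_wmx_anti U1) {1}[rho (lmx x)]mx2_eta !mul_mx2.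
rewrite !(mul0r, mulr0, add0r, addr0, mulr1) -/(lc x).
set p := rho (wmx 1) 0 1; set q := rho (wmx 1) 1 0.
have pU : p \is a GRing.unit.
  by rewrite cunitE rho_red ?mxE ?rmorph1 ?oner_eq0 //; apply: SL2_wmx.
have qU : q \is a GRing.unit.
  rewrite cunitE rho_red ?mxE /= ?invr1 ?rmorphN ?rmorph1 ?oppr_eq0 ?oner_eq0 //.
  exact: SL2_wmx.
case/mx2_inj=> h1 h2 h3 _; rewrite [LHS]mx2_eta; congr mx2.
- by apply: (mulIr pU); rewrite mul1r.
- by apply: (mulIr qU); rewrite mul0r.
- by apply: (mulIr qU); rewrite mul1r.
Qed.

(** In the product [wmxE] the upper left entry of the image is 1 plus this product, and it vanishes
    because the image is antidiagonal. *)
Let lc_inv x : x \is a GRing.unit -> tb x * lc (- x^-1) = -1.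
Proof.
move=> hx; have := rho_wmx_anti hx; have tx := SL2_tmx x.
have lx := SL2_lmx (- x^-1).
rewrite {1}(wmxE hx) (rhoM tx (SL2_mul lx tx)) (rhoM lx tx).
rewrite rho_tmx rho_lmx !mul_mx2 => /mx2_inj[h _ _ _].
by apply/eqP; rewrite -subr_eq0 opprK; apply/eqP; rewrite -[RHS]h; ring.
Qed.

Let lc_tb x : x \is a GRing.unit -> lc (- x^-1) = - (tb x)^-1.
Proof.
move=> hx; apply: (mulrI (tbU hx)).
by rewrite lc_inv // mulrN mulrV ?tbU.
Qed.

Let rho_wmx x : x \is a GRing.unit -> rho (wmx x) = wmx (tb x).
Proof.
move=> hx; have tx := SL2_tmx x; have lx := SL2_lmx (- x^-1).
rewrite (wmxE hx) (rhoM tx (SL2_mul lx tx)) (rhoM lx tx).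
by rewrite rho_tmx rho_lmx lc_tb // -wmxE ?tbU.
Qed.

Let rho_dmx x : x \is a GRing.unit -> rho (dmx x) = dmx (tb x).
Proof.
move=> hx; have N1 : (-1 : R) \is a GRing.unit by rewrite unitrN unitr1.
rewrite dmxE (rhoM (SL2_wmx hx) (SL2_wmx N1)) !rho_wmx //.
by rewrite tbN tb1 -dmxE.
Qed.

Let tbM_unit x y : x \is a GRing.unit -> y \is a GRing.unit ->
  tb (x * y) = tb x * tb y.
Proof.
move=> hx hy; have hxy : x * y \is a GRing.unit by rewrite unitrM hx.
have dxy : dmx (x * y) = dmx x *m dmx y.
  by rewrite mul_mx2 /dmx invrM // [y^-1 * _]mulrC; congr mx2; ring.
have := rho_dmx hxy; rewrite dxy (rhoM (SL2_dmx hx) (SL2_dmx hy)) !rho_dmx //.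
by rewrite mul_mx2 => /mx2_inj[+ _ _ _]; rewrite mulr0 addr0.
Qed.

(* Every element of a local ring is a unit or [1] plus a unit. *)
Let unit_ind (P : R -> Prop) :
  (forall x, x \is a GRing.unit -> P x) -> (forall x y, P x -> P y -> P (x + y)) ->
  forall x, P x.
Proof.
move=> hU hD x; have [h|h] := eqVneq (cred R x) 0; last by apply: hU; rewrite cunitE.
rewrite -[x](subrK 1); apply: hD; apply: hU; last exact: unitr1.
by rewrite cunitE rmorphB rmorph1 /= h sub0r oppr_eq0 oner_eq0.
Qed.

Let tbM x y : tb (x * y) = tb x * tb y.
Proof.
elim/unit_ind: x => [x hx|x x' h h']; last by rewrite mulrDl !tbD h h' mulrDl.
elim/unit_ind: y => [y hy|y y' h h']; last by rewrite mulrDr !tbD h h' mulrDr.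
exact: tbM_unit.
Qed.

(** For a unit, [lc_tb] at [- x^-1] gives the inverse of [tb x^-1], which is [tb x] by
    multiplicativity; additivity extends this to all [x]. *)
Let lcE x : lc x = tb x.
Proof.
elim/unit_ind: x => [x hx|x y hx hy].
  have hN : - x^-1 \is a GRing.unit by rewrite unitrN unitrV.
  have := lc_tb hN; rewrite invrN invrK opprK => ->.
  have vU : tb x^-1 \is a GRing.unit by apply: tbU; rewrite unitrV.
  by rewrite tbN invrN opprK; apply: (mulIr vU); rewrite mulVr // -tbM mulrV.
rewrite tbD -hx -hy {1}/lc lmxD (rhoM (SL2_lmx x) (SL2_lmx y)) !rho_lmx.
by rewrite mul_mx2 mxE /= mulr1 mul1r.
Qed.

Lemma normalized_rep_induced :
  exists f : {rmorphism R -> S}, chom f /\ forall g, inSL2 g -> rho g = map_mx f g.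
Proof.
have tbB : zmod_morphism tb by move=> x y; rewrite tbD tbN.
have tb_mon : monoid_morphism tb by split; [exact: tb1 | exact: tbM].
pose fZ := GRing.isZmodMorphism.Build R S tb tbB.
pose fM := GRing.isMonoidMorphism.Build R S tb tb_mon.
pose f : {rmorphism R -> S} := HB.pack tb fZ fM.
have fE x : f x = tb x by [].
exists f; split; first exact: tb_red.
have tE x : rho (tmx x) = map_mx f (tmx x).
  by rewrite rho_tmx map_mx2 rmorph0 rmorph1.
have lE x : rho (lmx x) = map_mx f (lmx x).
  by rewrite rho_lmx lcE map_mx2 rmorph0 rmorph1.
have dE x : x \is a GRing.unit -> rho (dmx x) = map_mx f (dmx x).
  by move=> hx; rewrite rho_dmx // map_mx2 rmorph0 rmorphV.
have main g : inSL2 g -> g 0 0 \is a GRing.unit -> rho g = map_mx f g.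
  move=> hg hu; have sd := SL2_dmx hu.
  rewrite [in LHS](SL2_LDU hg hu) [in RHS](SL2_LDU hg hu) !map_mxM.
  rewrite (rhoM (SL2_lmx _) (SL2_mul sd (SL2_tmx _))) (rhoM sd (SL2_tmx _)).
  by rewrite tE lE dE.
(* If the pivot is not a unit, the determinant forces [g 1 0] to be one; adding the second row to
   the first then makes the pivot a unit. *)
move=> g hg; have [g00|g00] := eqVneq (cred R (g 0 0)) 0; last first.
  by apply: main; rewrite ?cunitE.
have sh : inSL2 (tmx 1 *m g) by apply: SL2_mul => //; apply: SL2_tmx.
have gE : g = tmx (- 1) *m (tmx 1 *m g).
  rewrite mulmxA -tmxD addNr; have -> : tmx 0 = 1%:M :> 'M[R]_2 by exact: mx2_1.
  by rewrite mul1mx.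
rewrite {1}gE (rhoM (SL2_tmx _) sh) tE main ?sh -?map_mxM -?gE //.
rewrite cunitE {1}[g]mx2_eta mul_mx2 mxE /= !mul1r rmorphD /= g00 add0r.
apply/eqP => g10; move: hg; rewrite /inSL2 [g in \det g]mx2_eta det_mx2.
move/(congr1 (cred R)); rewrite rmorphB !rmorphM rmorph1 /= g00 g10.
by rewrite mul0r mulr0 subrr => /esym/eqP; rewrite oner_eq0.
Qed.

End NormalizedRepresentation.

(** * Strict conjugation to the normalized form *)

Lemma unitmx_cong1 (k : finFieldType) (S : cobj k) (Q : 'M[S]_2) :
  map_mx (cred S) Q = 1%:M -> Q \in unitmx.
Proof.
by move=> hQ; rewrite unitmxE cunitE -det_map_mx hQ det1 oner_eq0.
Qed.

Lemma sl2_rep_conj (k : finFieldType) (R S : cobj k) (rho : 'M[R]_2 -> 'M[S]_2) Q :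
  sl2_rep rho -> map_mx (cred S) Q = 1%:M ->
  sl2_rep (fun g => invmx Q *m rho g *m Q).
Proof.
case=> hU hM hred hQ; have QU := unitmx_cong1 hQ; split.
- by move=> g hg; rewrite !unitmx_mul unitmx_inv QU hU.
- by move=> g h hg hh; rewrite hM // !mulmxA mulmxK.
- move=> g hg; rewrite !map_mxM hQ mulmx1 hred //.
  have -> : map_mx (cred S) (invmx Q) = 1%:M.
    by rewrite -[LHS]mulmx1 -{1}hQ -map_mxM mulVmx // map_mx1.
  by rewrite mul1mx.
Qed.

(** The columns of [P] are eigenvectors [(1, y)] and [(z, 1)]. Eliminating the eigenvalue leaves one
    quadratic equation for [y] and one for [z], each solvable by [hensel_quadratic]. *)
Lemma diagonalize_mx2 (k : finFieldType) (S : cobj k) (M : 'M[S]_2) :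
  cmax S (M 0 1) -> cmax S (M 1 0) -> cred S (M 0 0) != cred S (M 1 1) ->
  exists (P : 'M[S]_2) (lam mu : S),
    map_mx (cred S) P = 1%:M /\ M *m P = P *m mx2 lam 0 0 mu.
Proof.
rewrite [M]mx2_eta !mxE /=; move: (M 0 0) (M 0 1) (M 1 0) (M 1 1) => p q r s hq hr hps.
have [|y [ym hy]] := @hensel_quadratic _ _ q (p - s) r hq _ hr.
  by rewrite rmorphB subr_eq0.
have [|z [zm hz]] := @hensel_quadratic _ _ r (s - p) q hr _ hq.
  by rewrite rmorphB subr_eq0 eq_sym.
exists (mx2 1 z y 1), (p + q * y), (s + r * z); split.
  by rewrite map_mx2 rmorph1 [cred S z]zm [cred S y]ym mx2_1.
rewrite !mul_mx2; congr mx2; try by ring.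
- by rewrite -[in LHS]hz; ring.
- by rewrite -[in LHS]hy; ring.
Qed.

(** Otherwise all elements are roots of ['X^5 - 'X], so [k] has at most 5 elements, hence exactly 4.
    Then [x ^+ 4 = x], which leaves only 0 and 1. *)
Lemma exists_fourth_power_neq1 (k : finFieldType) :
  #|k| \notin [:: 2; 3; 5]%N -> exists a : k, a != 0 /\ a ^+ 4 != 1.
Proof.
move=> hk; pose Z : pred k := [pred x | (x == 0) || (x ^+ 4 == 1)].
suff [a ha] : exists a, ~~ Z a.
  by exists a; move: ha; rewrite /= negb_or => /andP.
apply/existsP; rewrite -negb_forall; apply/negP => /forallP hZ.
have root5 (x : k) : x ^+ 5 = x.
  by have /orP[/eqP ->|/eqP h] := hZ x; rewrite ?expr0n // exprS h mulr1.
pose p : {poly k} := 'X^5 - 'X.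
have szp : size p = 6%N by rewrite size_polyDl ?size_polyN ?size_polyX size_polyXn.
have p_neq0 : p != 0 by rewrite -size_poly_eq0 szp.
have le5 : (#|k| <= 5)%N.
  rewrite cardE -ltnS -szp; apply: max_poly_roots => //; last exact: enum_uniq.
  by apply/allP => x _; rewrite /root !hornerE root5 subrr.
have gt1 : (1 < #|k|)%N by apply: finNzRing_gt1.
have card4 : #|k| = 4%N.
  by move: hk le5 gt1; case: #|k| => [|[|[|[|[|[|n]]]]]].
have : (#|k| <= size [:: 0%R; 1%R : k])%N.
  rewrite cardE; apply: uniq_leq_size; first exact: enum_uniq.
  move=> x _; rewrite !inE; have := hZ x; rewrite /Z /=.
  by rewrite -card4 expf_card.
by rewrite card4.
Qed.

Lemma lift_sl2_rep (k : finFieldType) (R S : cobj k) (rho : 'M[R]_2 -> 'M[S]_2) :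
  is_lift rho -> sl2_rep rho.
Proof. by case. Qed.

Lemma sl2_rep_induced (k : finFieldType) (R S : cobj k) (rho : 'M[R]_2 -> 'M[S]_2) :
  #|k| \notin [:: 2; 3; 5]%N -> sl2_rep rho ->
  exists f : {rmorphism R -> S}, chom f /\ strict_equiv (fun g => map_mx f g) rho.
Proof.
move=> hk rhoP; have [abar [a0 a4]] := exists_fourth_power_neq1 hk.
have [a aE] := cred_surj R abar; rewrite -{}aE in a0 a4.
have aU : a \is a GRing.unit by rewrite cunitE.
have red g i j : inSL2 g -> cred S (rho g i j) = cred R (g i j).
  by case: rhoP => _ _ h /h /matrixP/(_ i j); rewrite !mxE.
have sd := SL2_dmx aU.
have [|||P [lam [mu [P1 hP]]]] := @diagonalize_mx2 _ _ (rho (dmx a)).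
- by rewrite /cmax red // mxE rmorph0.
- by rewrite /cmax red // mxE rmorph0.
- rewrite !red // !mxE /= rmorphV //; apply: contra a4 => /eqP h.
  by rewrite (exprM _ 2 2) [cred R a ^+ 2]expr2 {2}h mulfV // expr1n.
have PU := unitmx_cong1 P1; have rho1P := sl2_rep_conj rhoP P1.
pose s : S := (invmx P *m rho (tmx 1) *m P) 0 1.
have s1 : cred S s = 1.
  have [_ _ /(_ _ (SL2_tmx 1))/matrixP/(_ 0 1)] := rho1P.
  by rewrite [LHS]mxE -/s => ->; rewrite !mxE rmorph1.
have sU : s \is a GRing.unit by rewrite cunitE s1 oner_eq0.
(* Conjugation by [D] divides the upper right entry by [s] and keeps [rho (dmx a)] diagonal; it is
   strict because [s] reduces to 1. *)
pose D := mx2 s 0 0 1.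
have D1 : map_mx (cred S) D = 1%:M by rewrite map_mx2 s1 rmorph0 rmorph1 mx2_1.
have DU := unitmx_cong1 D1; have rho2P := sl2_rep_conj rho1P D1.
have DV : invmx D = mx2 s^-1 0 0 1.
  apply: (can_inj (mulmxK DU)); rewrite mulVmx // mul_mx2 mulVr //.
  by rewrite !(mulr0, mul0r, addr0, add0r, mulr1) mx2_1.
have [||f [fhom fE]] := normalized_rep_induced (lam := lam) (mu := mu) rho2P a4 a0.
- rewrite -[_ *m rho _ *m _]mulmxA hP mulKmx // DV !mul_mx2.
  by congr mx2; rewrite !(mulr0, mul0r, addr0, add0r, mulr1, mul1r) // mulrC mulrA mulrV // mul1r.
- rewrite [X in _ *m X *m _]mx2_eta DV !mul_mx2 mxE /= -/s.
  by rewrite !(mulr0, mul0r, addr0, add0r, mulr1) mulVr.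
exists f; split=> //; exists (P *m D); split.
  move=> i j; rewrite /cmax.
  have : map_mx (cred S) (P *m D - 1%:M) = 0.
    by rewrite map_mxB map_mxM P1 D1 mulmx1 map_mx1 subrr.
  by move/matrixP/(_ i j); rewrite [LHS]mxE [RHS]mxE.
have PDU : P *m D \in unitmx by rewrite unitmx_mul PU.
move=> g hg; rewrite -fE //; apply: (can_inj (mulmxK PDU)).
by rewrite /= mulmxKV // !mulmxA mulmxK // mulmxV // mul1mx.
Qed.

(** * Lifts induced by ring morphisms, and uniqueness of the morphism *)

Lemma mpow_rmorph (k : finFieldType) (R S : cobj k) (f : {rmorphism R -> S}) n x :
  chom f -> cmpow R n x -> cmpow S n (f x).
Proof.
move=> hf; elim: n x => // n IH x [l [h ->]].
rewrite rmorph_sum big_seq; elim/big_ind: _ => [|y z|p /h[h1 h2]].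
- exact: mpow0.
- exact: mpowD.
- by rewrite rmorphM; apply: cmpowS; [rewrite /cmax hf | apply: IH].
Qed.

Lemma chom_lift (k : finFieldType) (R S : cobj k) (f : {rmorphism R -> S}) :
  chom f -> is_lift (fun g : 'M[R]_2 => map_mx f g).
Proof.
move=> hf; split.
- by move=> g hg; rewrite unitmxE det_map_mx hg rmorph1 unitr1.
- by move=> g h _ _; rewrite map_mxM.
- by move=> g _; apply/matrixP => i j; rewrite !mxE hf.
- move=> j; exists j => g _ hg i i'; have := mpow_rmorph hf (hg i i').
  by rewrite !mxE rmorphB rmorph_nat.
Qed.

(** The conjugating matrix [P] commutes with [lmx 1], so its diagonal entries agree. The upper right
    entry of the relation for [tmx x] then gives the equality after cancelling this common unit. *)
Lemma strict_equiv_chom_eq (k : finFieldType) (R S : cobj k) (f f' : {rmorphism R -> S}) :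
  strict_equiv (fun g : 'M[R]_2 => map_mx f g) (fun g => map_mx f' g) -> f =1 f'.
Proof.
case=> P [P1 hP] x.
have PU : P \in unitmx.
  apply: unitmx_cong1; apply/eqP; rewrite -subr_eq0 -(map_mx1 (cred S)) -map_mxB.
  by apply/eqP/matrixP => i j; rewrite [LHS]mxE [RHS]mxE; apply: P1.
have comm g : inSL2 g -> map_mx f' g *m P = P *m map_mx f g.
  by move/hP => ->; rewrite mulmxKV.
have := comm _ (SL2_lmx 1); have := comm _ (SL2_tmx x).
rewrite !map_mx2 !rmorph0 !rmorph1 [P]mx2_eta !mul_mx2.
rewrite !(mulr0, mul0r, addr0, add0r, mulr1, mul1r).
case/mx2_inj=> _ + _ _ /mx2_inj[_ _ + _] => h1 h2.
have p00 : P 0 0 = P 1 1 by apply: (addIr (P 1 0)); rewrite h2 addrC.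
have p1 : cred S (P 0 0) = 1.
  by have := P1 0 0; rewrite /cmax !mxE rmorphB rmorph1 => /eqP; rewrite subr_eq0 => /eqP.
move: h1; rewrite [X in _ = X]addrC => /addrI h1.
have hU : P 0 0 \is a GRing.unit by rewrite cunitE p1 oner_eq0.
by apply: (mulrI hU); rewrite -h1 p00 mulrC.
Qed.

(* k not in {F_2, F_3, F_5}; iota = inclusion SL_2(R) -> GL_2(R) *)
Theorem mainTheorem7 (k : finFieldType) (R : cobj k)
  (hk : #|k| \notin [:: 2; 3; 5]%N) :
  universal_lift (fun g : 'M[R]_2 => g).
Proof.
split; last first.
  move=> S; split.
  - exact: chom_lift.
  - by move=> rho /lift_sl2_rep; apply: sl2_rep_induced.
  - by move=> f f' _ _; apply: strict_equiv_chom_eq.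
split=> //.
- by move=> g hg; rewrite unitmxE hg unitr1.
- by move=> j; exists j.
Qed.
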